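(* Given a set $P$ of $n$ colored points and an ordered color set $C$, a backbone labeling with one label per color, labels in the given color order, infinite backbones, and the minimum number of crossings can be computed in $O(n|C|)$ time.
   Context: Setting: $P$ is a finite set of points in an axis-aligned rectangle $R$; each $p\in P$ has a color $c(p)\in C$, where $C=\{1,\dots,|C|\}$ is ordered; no two points share the same $x$- or the same $y$-coordinate, and the points are given in decreasing order of $y$-coordinate. A backbone labeling with one label per color assigns to each color $i\in C$ a single label, described by the $y$-coordinate of its backbone; all points of color $i$ are connected to this label. The backbone leader of color $i$ consists of a horizontal segment at that height (the backbone) together with, for each point of color $i$, the vertical segment joining the point to the backbone. An infinite backbone spans the whole width of $R$. Leaders of distinct labels may cross but not overlap. Labels are in the given color order if for all colors $i<j$ the label (and backbone) of color $i$ is above that of color $j$. The positions of the backbones are otherwise free. The number of crossings is the number of pairs consisting of a backbone and a vertical segment belonging to a different label that cross each other; the minimum is taken over all labelings satisfying these requirements. *)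

(* Defs.v *)
From HB Require Import structures.
From mathcomp Require Import all_boot all_order all_algebra.
From mathcomp Require Import reals.

Set Implicit Arguments.
Unset Strict Implicit.
Unset Printing Implicit Defensive.

Import Order.TTheory GRing.Theory Num.Theory.
Local Open Scope ring_scope.

(* An instance has n colored points in the closed rectangle
   [xmin, xmax] x [ymin, ymax].  The ordered color set {1, ..., |C|} is 'I_m
   with m = |C|; a color need not be used by any point. *)
Record instance (R : realType) (n m : nat) := Instance {
  xmin : R; xmax : R; ymin : R; ymax : R;
  px : 'I_n -> R;
  py : 'I_n -> R;
  color : 'I_n -> 'I_m;
  xmin_lt_xmax : xmin < xmax;
  ymin_lt_ymax : ymin < ymax;
  px_in : forall p, xmin <= px p <= xmax;
  py_in : forall p, ymin <= py p <= ymax;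
  px_inj : injective px;
  py_decreasing : forall p q : 'I_n, (p < q)%N -> py q < py p
}.

(* A labeling is the function h giving, for each color, the y-coordinate of
   the backbone of its unique label; h ranges over all of R. *)

Definition backbone (R : realType) n m (I : instance R n m) (h : 'I_m -> R)
    (i : 'I_m) : pred (R * R) :=
  fun z => (xmin I <= z.1 <= xmax I) && (z.2 == h i).

Definition vsegment (R : realType) n m (I : instance R n m) (h : 'I_m -> R)
    (p : 'I_n) : pred (R * R) :=
  fun z => (z.1 == px I p) &&
    (Num.min (py I p) (h (color I p)) <= z.2
       <= Num.max (py I p) (h (color I p))).

Inductive leader_part (R : realType) n m (I : instance R n m) (h : 'I_m -> R)
    (i : 'I_m) : pred (R * R) -> Prop :=
| LeaderBackbone : leader_part I h i (backbone I h i)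
| LeaderVertical p : color I p = i -> leader_part I h i (vsegment I h p).

(* For two line segments (convex sets), having two distinct common points
   means sharing a nondegenerate segment. *)
Definition segments_overlap (R : realType) (A B : pred (R * R)) : Prop :=
  exists u v : R * R, [/\ u <> v, A u, A v, B u & B v].

Definition leaders_overlap (R : realType) n m (I : instance R n m)
    (h : 'I_m -> R) (i j : 'I_m) : Prop :=
  exists A B, [/\ leader_part I h i A, leader_part I h j B
                & segments_overlap A B].

Definition in_color_order (R : realType) m (h : 'I_m -> R) : Prop :=
  forall i j : 'I_m, (i < j)%N -> h j < h i.

Definition admissible (R : realType) n m (I : instance R n m)
    (h : 'I_m -> R) : Prop :=
  in_color_order h /\
  (forall i j : 'I_m, i <> j -> ~ leaders_overlap I h i j).

(* The point (px p, h i) is the only point that the backbone of i and the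
   vertical segment of p can have in common.  A backbone running through a
   point of another color counts as a crossing; not counting or forbidding it
   would give the same minimum, since such a backbone can be shifted slightly
   to the side away from the segment. *)
Definition crosses (R : realType) n m (I : instance R n m) (h : 'I_m -> R)
    (i : 'I_m) (p : 'I_n) : bool :=
  backbone I h i (px I p, h i) && vsegment I h p (px I p, h i).

Definition crossings (R : realType) n m (I : instance R n m)
    (h : 'I_m -> R) : nat :=
  #|[set ip : 'I_m * 'I_n |
      (color I ip.2 != ip.1) && crosses I h ip.1 ip.2]|.

Definition crossing_minimal (R : realType) n m (I : instance R n m)
    (h : 'I_m -> R) : Prop :=
  admissible I h /\
  (forall h', admissible I h' -> (crossings I h <= crossings I h')%N).

(* Model of computation: a unit-cost real RAM presented as a structured
   language.  The memory consists of cells holding natural numbers and cells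
   holding reals, organized in arrays.  Array names are literals of the
   program, so a program has finitely many arrays; cell indices are computed
   (indirect addressing).  Naturals have addition, truncated subtraction and
   comparison, but no multiplication; reals have the four field operations and
   comparison, but no rounding or other conversion to naturals. *)

Inductive nexp :=
| NConst of nat
| NGet of nat & nexp
| NAdd of nexp & nexp
| NSub of nexp & nexp.

Inductive rexp :=
| RZero
| ROne
| RGet of nat & nexp
| RAdd of rexp & rexp
| RSub of rexp & rexp
| RMul of rexp & rexp
| RDiv of rexp & rexp.

Inductive bexp :=
| BNEq of nexp & nexp
| BNLt of nexp & nexp
| BREq of rexp & rexp
| BRLt of rexp & rexp
| BNot of bexp
| BAnd of bexp & bexp.

Inductive cmd :=
| Skip
| NSet of nat & nexp & nexp  (* NSet a e v : a[e] := v on naturals *)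
| RSet of nat & nexp & rexp  (* RSet a e v : a[e] := v on reals *)
| Seq of cmd & cmd
| If of bexp & cmd & cmd
| While of bexp & cmd.

Record state (R : realType) := State {
  nmem : nat -> nat -> nat;
  rmem : nat -> nat -> R
}.

Definition update T (M : nat -> nat -> T) (a k : nat) (v : T) :
    nat -> nat -> T :=
  fun b l => if (b == a) && (l == k) then v else M b l.

Definition nwrite (R : realType) (s : state R) (a k v : nat) : state R :=
  State (update (nmem s) a k v) (rmem s).

Definition rwrite (R : realType) (s : state R) (a k : nat) (v : R) : state R :=
  State (nmem s) (update (rmem s) a k v).

Fixpoint neval (R : realType) (s : state R) (e : nexp) : nat :=
  match e with
  | NConst k => k
  | NGet a e1 => nmem s a (neval s e1)
  | NAdd e1 e2 => (neval s e1 + neval s e2)%N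
  | NSub e1 e2 => (neval s e1 - neval s e2)%N
  end.

Fixpoint reval (R : realType) (s : state R) (e : rexp) : R :=
  match e with
  | RZero => 0
  | ROne => 1
  | RGet a e1 => rmem s a (neval s e1)
  | RAdd e1 e2 => reval s e1 + reval s e2
  | RSub e1 e2 => reval s e1 - reval s e2
  | RMul e1 e2 => reval s e1 * reval s e2
  | RDiv e1 e2 => reval s e1 / reval s e2
  end.

Fixpoint beval (R : realType) (s : state R) (e : bexp) : bool :=
  match e with
  | BNEq e1 e2 => neval s e1 == neval s e2
  | BNLt e1 e2 => (neval s e1 < neval s e2)%N
  | BREq e1 e2 => reval s e1 == reval s e2
  | BRLt e1 e2 => reval s e1 < reval s e2
  | BNot e1 => ~~ beval s e1
  | BAnd e1 e2 => beval s e1 && beval s e2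
  end.

(* Evaluating an expression costs one unit per node. *)

Fixpoint ncost (e : nexp) : nat :=
  match e with
  | NConst _ => 1
  | NGet _ e1 => (ncost e1).+1
  | NAdd e1 e2 | NSub e1 e2 => (ncost e1 + ncost e2).+1
  end.

Fixpoint rcost (e : rexp) : nat :=
  match e with
  | RZero | ROne => 1
  | RGet _ e1 => (ncost e1).+1
  | RAdd e1 e2 | RSub e1 e2 | RMul e1 e2 | RDiv e1 e2 =>
      (rcost e1 + rcost e2).+1
  end.

Fixpoint bcost (e : bexp) : nat :=
  match e with
  | BNEq e1 e2 | BNLt e1 e2 => (ncost e1 + ncost e2).+1
  | BREq e1 e2 | BRLt e1 e2 => (rcost e1 + rcost e2).+1
  | BNot e1 => (bcost e1).+1
  | BAnd e1 e2 => (bcost e1 + bcost e2).+1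
  end.

(* exec c s s' t : started in s, c terminates in s' after exactly t steps. *)
Inductive exec (R : realType) : cmd -> state R -> state R -> nat -> Prop :=
| ExecSkip s : exec Skip s s 1
| ExecNSet s a e v :
    exec (NSet a e v) s (nwrite s a (neval s e) (neval s v))
      (ncost e + ncost v).+1
| ExecRSet s a e v :
    exec (RSet a e v) s (rwrite s a (neval s e) (reval s v))
      (ncost e + rcost v).+1
| ExecSeq c1 c2 s1 s2 s3 t1 t2 :
    exec c1 s1 s2 t1 -> exec c2 s2 s3 t2 ->
    exec (Seq c1 c2) s1 s3 (t1 + t2)
| ExecIf b c1 c2 s s' t :
    exec (if beval s b then c1 else c2) s s' t ->
    exec (If b c1 c2) s s' (bcost b + t).+1
| ExecWhileEnd b c s :
    beval s b = false ->
    exec (While b c) s s (bcost b).+1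
| ExecWhileLoop b c s1 s2 s3 t1 t2 :
    beval s1 b = true ->
    exec c s1 s2 t1 -> exec (While b c) s2 s3 t2 ->
    exec (While b c) s1 s3 (bcost b + t1 + t2).+1.

Definition load (n : nat) T (x0 : T) (f : 'I_n -> T) (k : nat) : T :=
  if insub k is Some p then f p else x0.

(* Input.  Natural array 0 holds n and m, natural array 1 the colors of the
   points (color number i is represented by i - 1); real arrays 0 and 1 hold
   the x- and y-coordinates of the points, real array 2 the rectangle.  All
   other cells are 0. *)
Definition input (R : realType) n m (I : instance R n m) : state R :=
  State
    (fun a => match a with
              | 0%N => nth 0%N [:: n; m]
              | 1%N => load 0%N (fun p => nat_of_ord (color I p))
              | _ => fun=> 0%N
              end)
    (fun a => match a with
              | 0%N => load 0 (px I)
              | 1%N => load 0 (py I)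
              | 2%N => nth 0 [:: xmin I; xmax I; ymin I; ymax I]
              | _ => fun=> 0
              end).

(* Output: real array 3 holds the heights of the backbones. *)
Definition output (R : realType) m (s : state R) : 'I_m -> R :=
  fun i => rmem s 3 i.

(* Main.v *)
(** Leaders of distinct colors never overlap once the heights are strictly
    decreasing, and then the number of crossings is a sum over the colors [i] of
    a cost depending only on the gap [k] between consecutive points in which the
    backbone of [i] runs: the [k] points above it cost 1 if their color is
    greater than [i], the others cost 1 if their color is smaller.  Moving from
    gap [k] to [k.+1] changes this cost by the sign of [color k - i], which is
    nonincreasing in [i].  Hence the leftmost optimal gaps of the single colors
    are automatically monotone in [i], and it suffices to minimise for each color
    independently with one scan over the points. *)

Require Import Defs.
From mathcomp Require Import all_boot all_order all_algebra.
From mathcomp Require Import reals.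
From mathcomp Require Import boolp zify lra.

Set Implicit Arguments.
Unset Strict Implicit.
Unset Printing Implicit Defensive.

Import Order.TTheory GRing.Theory Num.Theory.
Local Open Scope ring_scope.

(** * Time-bounded total correctness of commands *)

Definition runs (R : realType) (c : cmd) (s : state R) (T : nat)
    (Q : state R -> Prop) : Prop :=
  exists s' t, [/\ exec c s s' t, (t <= T)%N & Q s'].

Section Runs.
Variable R : realType.
Implicit Types (s : state R) (Q P : state R -> Prop).

Lemma runs_skip s Q : Q s -> runs Skip s 1 Q.
Proof. by move=> Qs; exists s, 1%N; split=> //; constructor. Qed.

Lemma runs_nset s a e v Q :
  Q (nwrite s a (neval s e) (neval s v)) ->
  runs (NSet a e v) s (ncost e + ncost v).+1 Q.
Proof. by move=> Qs; do 2 eexists; split; [constructor | |]. Qed.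

Lemma runs_rset s a e v Q :
  Q (rwrite s a (neval s e) (reval s v)) ->
  runs (RSet a e v) s (ncost e + rcost v).+1 Q.
Proof. by move=> Qs; do 2 eexists; split; [constructor | |]. Qed.

Lemma runs_seq c1 c2 s T1 T2 P Q :
  runs c1 s T1 P -> (forall s', P s' -> runs c2 s' T2 Q) ->
  runs (Seq c1 c2) s (T1 + T2) Q.
Proof.
move=> [s1 [t1 [e1 le1 P1]]] /(_ _ P1) [s2 [t2 [e2 le2 Q2]]].
by exists s2, (t1 + t2)%N; split; [apply: ExecSeq e1 e2 | apply: leq_add |].
Qed.

Lemma runs_if b c1 c2 s T1 T2 Q :
  (beval s b = true -> runs c1 s T1 Q) ->
  (beval s b = false -> runs c2 s T2 Q) ->
  runs (If b c1 c2) s (bcost b + maxn T1 T2).+1 Q.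
Proof.
move=> H1 H2; have [s' [t [e le_t Qs']]] :
    runs (if beval s b then c1 else c2) s (maxn T1 T2) Q.
  case: (beval s b) H1 H2 => [H _|_ H]; have [s' [t [e le_t Qs']]] := H erefl;
    by exists s', t; split=> //; rewrite leq_max le_t ?orbT.
exists s', (bcost b + t).+1; split=> //; first exact: ExecIf.
by rewrite ltnS leq_add2l.
Qed.

Lemma runs_nset_seq s a e v c T Q :
  runs c (nwrite s a (neval s e) (neval s v)) T Q ->
  runs (Seq (NSet a e v) c) s ((ncost e + ncost v).+1 + T) Q.
Proof. by move=> Qs; apply: runs_seq (runs_nset (erefl _)) _ => _ <-. Qed.

Lemma runs_rset_seq s a e v c T Q :
  runs c (rwrite s a (neval s e) (reval s v)) T Q ->
  runs (Seq (RSet a e v) c) s ((ncost e + rcost v).+1 + T) Q.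
Proof. by move=> Qs; apply: runs_seq (runs_rset (erefl _)) _ => _ <-. Qed.

Lemma runs_weaken c s T T' P Q :
  runs c s T P -> (T <= T')%N -> (forall s', P s' -> Q s') -> runs c s T' Q.
Proof.
move=> [s' [t [e le_t Ps']]] leT PQ; exists s', t; split; auto.
exact: leq_trans le_t leT.
Qed.

(** The invariant is indexed by the number of completed rounds, so the guard is true exactly in the
    first [N] rounds, and one extra guard evaluation ends the loop. *)
Lemma runs_while b c s N T (Inv : nat -> state R -> Prop) :
  Inv 0%N s ->
  (forall j s', Inv j s' -> beval s' b = (j < N)%N) ->
  (forall j s', (j < N)%N -> Inv j s' -> runs c s' T (Inv j.+1)) ->
  runs (While b c) s (N * (bcost b + T).+1 + (bcost b).+1) (Inv N).
Proof.
move=> Inv0 Hb Hc.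
suff H j : forall k s', (k + j = N)%N -> Inv k s' ->
    runs (While b c) s' (j * (bcost b + T).+1 + (bcost b).+1) (Inv N) by exact: (H N 0%N s).
elim: j => [|j IHj] k s' kj Invk.
  exists s', (bcost b).+1; split=> //; last by rewrite -kj addn0.
  by apply: ExecWhileEnd; rewrite (Hb _ _ Invk); lia.
have lt_kN : (k < N)%N by lia.
have [s1 [t1 [e1 le1 Inv1]]] := Hc _ _ lt_kN Invk.
have [|s2 [t2 [e2 le2 Inv2]]] := IHj k.+1 s1 _ Inv1; first by lia.
exists s2, (bcost b + t1 + t2).+1; split=> //; last by rewrite mulSn; lia.
by apply: ExecWhileLoop e1 e2; rewrite (Hb _ _ Invk).
Qed.

End Runs.

Lemma load_ord n T (x0 : T) (f : 'I_n -> T) (p : 'I_n) : load x0 f p = f p.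
Proof. by rewrite /load valK. Qed.

Lemma load_out n T (x0 : T) (f : 'I_n -> T) k : (n <= k)%N -> load x0 f k = x0.
Proof. by move=> le_nk; rewrite /load insubF // ltnNge le_nk. Qed.

(** * Gap costs of a single color and monotonicity of their leftmost minima *)

Section GapCost.
Variables (n : nat) (c : 'I_n -> nat).

(* The gap [k] lies just below the first [k] points. *)
Definition gap_cost (i k : nat) : nat :=
  \sum_(p < n) (if (p < k)%N then (i < c p)%N else (c p < i)%N).

(** Only the term of [j] changes when [j] passes from below to above the gap. Both sides are sums to
    avoid truncated subtraction. *)
Lemma gap_costS i (j : 'I_n) :
  (gap_cost i j.+1 + (c j < i) = gap_cost i j + (i < c j))%N.
Proof.
rewrite /gap_cost (bigD1 j) //= [in RHS](bigD1 j) //= ltnSn ltnn /=.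
rewrite (eq_bigr (fun p : 'I_n => nat_of_bool
  (if (p < j)%N then (i < c p)%N else (c p < i)%N))); last first.
  by move=> p /negPf p_neq; rewrite ltnS leq_eqVlt (inj_eq val_inj) p_neq.
by rewrite addnAC [RHS]addnAC [(_ + (c j < i))%N]addnC.
Qed.

Lemma gap_cost0_le i : (gap_cost i 0 <= n)%N.
Proof.
rewrite -[leqRHS]card_ord -sum1_card; apply: leq_sum => p _ /=.
by case: (_ < _)%N.
Qed.

(** Together with [gap_cost0_le], this keeps the decrement in the scan from being truncated at 0. *)
Lemma gap_cost_gt0 i (j : 'I_n) : (c j < i)%N -> (0 < gap_cost i j)%N.
Proof. by move=> lt_ci; rewrite /gap_cost (bigD1 j) //= ltnn lt_ci. Qed.

(** Termwise: points outside the range from [k] to [k'] contribute equally to both sides, and for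
    the others the increment from [k] to [k'] is nonincreasing in the color. *)
Lemma gap_cost_submodular i i' k k' :
  (i <= i')%N -> (k <= k')%N ->
  (gap_cost i' k' + gap_cost i k <= gap_cost i k' + gap_cost i' k)%N.
Proof.
move=> le_i le_k; rewrite /gap_cost -!big_split /=; apply: leq_sum => p _.
case: (ltnP p k) => [/leq_trans-/(_ _ le_k) ->|_].
  by rewrite addnC.
case: ltnP => _; last by rewrite addnC.
by case: (ltngtP i (c p)); case: (ltngtP i' (c p)); lia.
Qed.

Definition leftmost_min (N : nat) (f : nat -> nat) (k : nat) : Prop :=
  [/\ (k <= N)%N, (forall l, (l <= N)%N -> (f k <= f l)%N)
    & (forall l, (l < k)%N -> (f k < f l)%N)].

(** Exchange argument: if [k' < k], then [k] is strictly better than [k'] for [i] and [k'] is no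
    worse than [k] for [i']; adding the two contradicts submodularity. *)
Lemma leftmost_gap_mono i i' k k' : (i <= i')%N ->
  leftmost_min n (gap_cost i) k -> leftmost_min n (gap_cost i') k' ->
  (k <= k')%N.
Proof.
move=> le_i [kn _ ltk] [_ min' _]; rewrite leqNgt; apply/negP => lt_k'k.
have := gap_cost_submodular le_i (ltnW lt_k'k).
by have := ltk _ lt_k'k; have := min' _ kn; lia.
Qed.

End GapCost.

(** * Labelings versus gap costs, and backbone heights realizing given gaps *)

Section Geometry.
Variables (R : realType) (n m : nat) (I : instance R n m).
Implicit Types (h : 'I_m -> R) (i : 'I_m) (p q : 'I_n).

Definition colorn p : nat := color I p.

(** Distinct backbones have distinct heights, vertical segments of distinct points have distinct
    abscissas, and a backbone meets a vertical segment in at most one point. *)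
Lemma in_color_order_admissible h : in_color_order h -> admissible I h.
Proof.
move=> ho; split=> // i j neq_ij [A [B [LA LB [[u1 u2] [[v1 v2] [uv]]]]]].
have hij : h i != h j.
  apply/eqP => e; case: (ltngtP i j) => [/ho|/ho|/val_inj //].
    by rewrite e ltxx.
  by rewrite e ltxx.
case: LA => [|p cp]; case: LB => [|q cq];
    rewrite /backbone /vsegment /= => /andP[a1 a2] /andP[b1 b2] /andP[c1 c2] /andP[d1 d2].
- by case/eqP: hij; rewrite -(eqP a2) -(eqP c2).
- by case: uv; rewrite (eqP a2) (eqP b2) (eqP c1) (eqP d1).
- by case: uv; rewrite (eqP a1) (eqP b1) (eqP c2) (eqP d2).
- case: neq_ij; rewrite -cp -cq; congr (color I _).
  by apply: (@px_inj _ _ _ I); rewrite -(eqP a1) -(eqP c1).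
Qed.

Lemma crossesE h i p :
  crosses I h i p = (Num.min (py I p) (h (color I p)) <= h i
                       <= Num.max (py I p) (h (color I p))).
Proof. by rewrite /crosses /backbone /vsegment /= (px_in I p) !eqxx. Qed.

Lemma crossings_sum h :
  crossings I h =
  (\sum_(i < m) \sum_(p < n) ((color I p != i) && crosses I h i p))%N.
Proof.
rewrite /crossings pair_bigA /= -sum1_card big_mkcond /=.
by apply: eq_bigr => -[i p] _; rewrite inE /=; case: (_ && _).
Qed.

Lemma gap_exists (y : R) :
  exists2 k, (k <= n)%N & forall p, (p < k)%N = (y < py I p).
Proof.
(* One past the last point above [y], or 0 if there is none; the points above [y] form an initial
   segment since the heights decrease. *)
exists (\max_(p < n | (y < py I p)%R) p.+1)%N; first by apply/bigmax_leqP.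
move=> p; apply/idP/idP => [|yp]; last first.
  exact: (@leq_bigmax_cond _ (fun q => y < py I q) (fun q : 'I_n => q.+1)).
case: (pickP (fun q => y < py I q)) => [q0 yq0|none]; last first.
  by rewrite big_pred0.
have [|q yq ->] := @eq_bigmax_cond _ (fun q => y < py I q) (fun q : 'I_n => q.+1).
  by apply/card_gt0P; exists q0.
rewrite ltnS leq_eqVlt => /predU1P[/val_inj -> //|lt_pq].
by apply: (@lt_trans _ _ (py I q)); [exact: yq | exact: py_decreasing].
Qed.

(** A point whose label lies on the other side of the backbone forces a crossing. A point exactly on
    the backbone counts as below it, and its segment still meets the backbone. *)
Lemma gap_cost_le_crossings h i : in_color_order h ->
  exists2 k, (k <= n)%N &
    (gap_cost colorn i k
       <= \sum_(p < n) ((color I p != i) && crosses I h i p))%N.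
Proof.
move=> ho; have [k kn kP] := gap_exists (h i); exists k => //.
apply: leq_sum => p _; rewrite kP crossesE /colorn ge_min le_max.
case: ltP => yp; case: ltngtP => //= /[dup] lt_c /ho lt_h.
  by rewrite -(inj_eq val_inj) /= gtn_eqF //= (ltW lt_h) (ltW yp).
by rewrite -(inj_eq val_inj) /= ltn_eqF //= (ltW lt_h) orbT.
Qed.

Lemma crossings_le_gap_cost h i k : in_color_order h ->
  (forall p, (p < k)%N -> h i < py I p) ->
  (forall p, (k <= p)%N -> py I p < h i) ->
  (\sum_(p < n) ((color I p != i) && crosses I h i p)
     <= gap_cost colorn i k)%N.
Proof.
move=> ho above below; apply: leq_sum => p _.
rewrite crossesE /colorn ge_min le_max -(inj_eq val_inj) /=.
case: ltnP => [/above|/below] yp; rewrite (lt_geF yp) /=;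
  by case: ltngtP => //= /ho lt_h; rewrite (lt_geF lt_h) ?andbF ?orbF ?leq_b1.
Qed.

Lemma crossing_minimal_gaps h (k : 'I_m -> nat) : in_color_order h ->
  (forall i, leftmost_min n (gap_cost colorn i) (k i)) ->
  (forall i p, (p < k i)%N -> h i < py I p) ->
  (forall i p, (k i <= p)%N -> py I p < h i) ->
  crossing_minimal I h.
Proof.
move=> ho kmin above below; split; first exact: in_color_order_admissible.
move=> h' [ho' _]; rewrite !crossings_sum; apply: leq_sum => i _.
have [l ln le_l] := gap_cost_le_crossings i ho'.
apply: leq_trans (crossings_le_gap_cost ho (above i) (below i)) _.
by apply: leq_trans le_l; case: (kmin i) => _ + _; apply.
Qed.

(* The gap [k] is the open interval from [level k.+1] to [level k]. *)
Definition level (k : nat) : R :=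
  if k is p.+1 then load (ymin I - 1) (py I) p else ymax I + 1.

Lemma level_ord p : level p.+1 = py I p.
Proof. exact: load_ord. Qed.

Lemma level_decreasing a b : (a < b <= n.+1)%N -> level b < level a.
Proof.
case: b => [|b]; first by rewrite ltn0.
rewrite !ltnS => /andP[ab bn].
(* Index [n] is past the last point, so [load] returns its default, the sentinel below the
   rectangle. *)
have below : level n.+1 = ymin I - 1 by rewrite /level load_out.
have yy := ymin_lt_ymax I.
have [/eqP ->|bn'] := boolP (b == n).
  rewrite below; case: a ab => [|a]; first by rewrite /level; lra.
  move=> ab; have an : (a < n)%N by lia.
  by rewrite -[a]/(val (Ordinal an)) level_ord; have := py_in I (Ordinal an); lra.
have {}bn : (b < n)%N by lia.
rewrite -[b]/(val (Ordinal bn)) level_ord; have := py_in I (Ordinal bn).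
case: a ab => [|a] ab; first by rewrite /level; lra.
have an : (a < n)%N by lia.
by rewrite -[a]/(val (Ordinal an)) level_ord => _; apply: py_decreasing.
Qed.

Lemma level_le a b : (a <= b <= n.+1)%N -> level b <= level a.
Proof.
move=> /andP[]; rewrite leq_eqVlt => /predU1P[-> //|ab bn].
by apply/ltW/level_decreasing; rewrite ab.
Qed.

(* The divisor [i.+2] keeps the backbones sharing a gap in color order. *)
Definition height (i k : nat) : R :=
  level k.+1 + (level k - level k.+1) / i.+2%:R.

Lemma height_in_gap (i k : nat) : (k <= n)%N -> level k.+1 < height i k < level k.
Proof.
move=> kn; rewrite /height; have : level k.+1 < level k.
  by apply: level_decreasing; rewrite ltnSn ltnS.
rewrite -subr_gt0 => d0; rewrite ltrDl divr_gt0 ?ltr0n //=.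
by rewrite -ltrBrDl ltr_pdivrMr ?ltr0n // ltr_pMr // ltr1n.
Qed.

Lemma height_decreasing (i j k l : nat) : (i < j)%N -> (k <= l <= n)%N ->
  height j l < height i k.
Proof.
move=> ij /andP[]; rewrite leq_eqVlt => /predU1P[->|kl] ln.
  rewrite /height ltrD2l ltr_pM2l; last first.
    by rewrite subr_gt0; apply: level_decreasing; rewrite ltnSn ltnS.
  by rewrite ltf_pV2 ?posrE ?ltr0n // ltr_nat !ltnS.
(* In different gaps the heights are separated by [level l <= level k.+1]. *)
have /andP[_ hj] := height_in_gap j ln.
have /andP[hi _] := height_in_gap i (leq_trans (ltnW kl) ln).
apply: lt_trans hj (le_lt_trans _ hi).
by apply: level_le; rewrite kl ltnW.
Qed.

Lemma crossing_minimal_heights h :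
  (forall i, exists2 k, leftmost_min n (gap_cost colorn i) k & h i = height i k) ->
  crossing_minimal I h.
Proof.
move=> hP.
have [|k kP] := @choice _ _ (fun (i : 'I_m) l =>
    leftmost_min n (gap_cost colorn i) l /\ h i = height i l).
  by move=> i; have [l lmin lh] := hP i; exists l.
have kn i : (k i <= n)%N by case: (kP i) => -[].
apply: (@crossing_minimal_gaps h k) => [i j ij|i|i p|i p].
- have [[imin ->] [jmin ->]] := (kP i, kP j).
  by apply: height_decreasing; rewrite // kn andbT;
    apply: leftmost_gap_mono (ltnW ij) imin jmin.
- by case: (kP i).
- move=> pk; have [_ ->] := kP i; have /andP[_ lt_h] := height_in_gap i (kn i).
  by apply: lt_le_trans lt_h _; rewrite -level_ord; apply: level_le; rewrite pk ltnW // ltnS kn.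
- move=> kp; have [_ ->] := kP i; have /andP[lt_h _] := height_in_gap i (kn i).
  by apply: le_lt_trans lt_h; rewrite -level_ord; apply: level_le; rewrite !ltnS kp ltnW.
Qed.

End Geometry.

(** * The program *)

Definition var (a : nat) : nexp := NGet a (NConst 0).
Definition setvar (a : nat) (v : nexp) : cmd := NSet a (NConst 0) v.
Definition incr (a : nat) : cmd := setvar a (NAdd (var a) (NConst 1)).

(* Natural variables: array 2 is the color, 3 the point, 4 the cost of the
   current gap up to a shift by a constant, 5 the least such cost so far, and 6
   the gap attaining it.  Real array 4 holds the levels, and 5 the divisor. *)
Definition copy_loop : cmd :=
  While (BNLt (var 3) (var 0))
    (Seq (RSet 4 (NAdd (var 3) (NConst 1)) (RGet 1 (var 3))) (incr 3)).

Definition scan_step : cmd :=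
  Seq (If (BNLt (var 2) (NGet 1 (var 3)))
         (incr 4)
         (If (BNLt (NGet 1 (var 3)) (var 2))
            (setvar 4 (NSub (var 4) (NConst 1))) Skip))
 (Seq (incr 3)
      (If (BNLt (var 4) (var 5))
         (Seq (setvar 5 (var 4)) (setvar 6 (var 3))) Skip)).

(** Naturals cannot be converted to reals, so the divisor is kept as a real and incremented with
    each color. *)
Definition color_step : cmd :=
  Seq (setvar 3 (NConst 0))
 (Seq (setvar 4 (var 0))
 (Seq (setvar 5 (var 0))
 (Seq (setvar 6 (NConst 0))
 (Seq (While (BNLt (var 3) (var 0)) scan_step)
 (Seq (RSet 3 (var 2)
         (RAdd (RGet 4 (NAdd (var 6) (NConst 1)))
               (RDiv (RSub (RGet 4 (var 6)) (RGet 4 (NAdd (var 6) (NConst 1))))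
                     (RGet 5 (NConst 0)))))
 (Seq (RSet 5 (NConst 0) (RAdd (RGet 5 (NConst 0)) ROne))
      (incr 2))))))).

(** After [copy_loop] the point variable equals [n], so the lower sentinel lands at index [n.+1]. *)
Definition backbone_program : cmd :=
  Seq (RSet 4 (NConst 0) (RAdd (RGet 2 (NConst 3)) ROne))
 (Seq copy_loop
 (Seq (RSet 4 (NAdd (var 3) (NConst 1)) (RSub (RGet 2 (NConst 2)) ROne))
 (Seq (RSet 5 (NConst 0) (RAdd ROne ROne))
      (While (BNLt (var 2) (NGet 0 (NConst 1))) color_step)))).

(** * Correctness and running time of the program *)

Section Program.
Variables (R : realType) (n m : nat) (I : instance R n m).

Definition has_input (s : state R) : Prop :=
  [/\ nmem s 0 0 = n, nmem s 0 1 = m & forall p : 'I_n, nmem s 1 p = color I p].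

Definition scanning (r : nat -> nat -> R) (i k v best bk : nat)
    (s : state R) : Prop :=
  [/\ has_input s, rmem s = r, nmem s 2 0 = i, nmem s 3 0 = k &
      [/\ nmem s 4 0 = v, nmem s 5 0 = best & nmem s 6 0 = bk]].

(** The counter starts at [n] instead of [gap_cost i 0], which saves a pass over the points. The
    constant shift does not affect comparisons between gaps. *)
Definition scan_inv r (i k : nat) (s : state R) : Prop :=
  exists v best bk, [/\ scanning r i k v best bk s,
    (v + gap_cost (colorn I) i 0 = n + gap_cost (colorn I) i k)%N,
    (best + gap_cost (colorn I) i 0 = n + gap_cost (colorn I) i bk)%N
    & leftmost_min k (gap_cost (colorn I) i) bk].

Lemma scan_step_runs r i (k : 'I_n) s : scan_inv r i k s ->
  runs scan_step s 40 (scan_inv r i k.+1).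
Proof.
move=> [v [best [bk [scan_s vE bestE [le_bk min_bk lt_bk]]]]].
set v' := (v + (i < colorn I k) - (colorn I k < i))%N.
have v'E : (v' + gap_cost (colorn I) i 0 = n + gap_cost (colorn I) i k.+1)%N.
  have := gap_costS (colorn I) i k; have := gap_cost0_le (colorn I) i.
  have := @gap_cost_gt0 _ (colorn I) i k; rewrite /v'.
  by case: ltngtP => //= _; [move=> /(_ isT)|move=> _|move=> _]; lia.
apply: runs_weaken.
  apply: (@runs_seq _ _ _ _ _ _ (scanning r i k v' best bk)) => [|s1].
  + case: scan_s => -[s0 s1 sc] rs s2 s3 [s4 s5 s6].
    apply: runs_if; rewrite /= s2 s3 sc -/(colorn I k) => lt1.
      by apply: runs_nset; rewrite /v' lt1; split=> //=; split=> //=; rewrite /update /= s4; lia.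
    apply: runs_if; rewrite /= s2 s3 sc -/(colorn I k) => lt2.
      by apply: runs_nset; rewrite /v' lt1 lt2; split=> //=; split=> //=; rewrite /update /= s4; lia.
    by apply: runs_skip; rewrite /v' lt1 lt2; split=> //=; split=> //=; lia.
  + case=> [[s10 s11 s1c] rs s12 s13 [s14 s15 s16]].
    apply: runs_nset_seq.
    (* Gap [k.+1] is the only new candidate; replacing the record only on strict improvement keeps
       it leftmost. *)
    have min_bkS l : (l <= k.+1)%N -> l = k.+1 \/ (l <= k)%N by lia.
    apply: runs_if; rewrite /= /update /= s14 s15 => lt.
      apply: runs_nset_seq; apply: runs_nset.
      instantiate (1 := scan_inv r i k.+1).
      exists v', v', k.+1; split=> //.
        by split=> //=; [|split]; rewrite /update /= ?s13 ?addn1 ?s14.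
      split=> // l; first by move=> /min_bkS[->//|/min_bk]; lia.
      by move=> /min_bk; lia.
    apply: runs_skip; exists v', best, bk; split=> //.
      by split=> //=; rewrite /update /= s13 addn1.
    split=> [|l /min_bkS[->|/min_bk //]|//]; first exact: leqW.
    by move: lt; lia.
  all: done.
Qed.

Definition color_inv (j : nat) (s : state R) : Prop :=
  [/\ has_input s, nmem s 2 0 = j, rmem s 5 0 = j.+2%:R,
      (forall l, (l <= n.+1)%N -> rmem s 4 l = level I l)
    & forall i : 'I_m, (i < j)%N ->
        exists2 k, leftmost_min n (gap_cost (colorn I) i) k
                 & rmem s 3 i = height I i k].

Lemma color_step_runs j s : (j < m)%N -> color_inv j s ->
  runs color_step s (100 * n.+1) (color_inv j.+1).
Proof.
move=> jm [[s0 s1 sc] s2 r5 r4 r3]; apply: runs_weaken.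
- do 4 apply: runs_nset_seq; apply: runs_seq.
    apply: (runs_while (N := n) (Inv := scan_inv (rmem s) j)).
    + exists n, n, 0%N; split=> //; last by split=> // l; rewrite leqn0 => /eqP->.
    + by move=> k s' [v [best [bk [[[s'0 _ _] _ _ s'3 _] _ _ _]]]]; rewrite /= s'3 s'0.
    + by move=> k s' kn; apply: (@scan_step_runs _ _ (Ordinal kn)).
  move=> s' [v [best [bk [[[s'0 s'1 s'c] rs' s'2 s'3 [s'4 s'5 s'6]] _ _ bk_min]]]].
  do 2 apply: runs_rset_seq; apply: runs_nset.
  instantiate (1 := color_inv j.+1).
  have bkn : (bk <= n)%N by case: bk_min.
  split=> //=; rewrite /update /=.
  + by rewrite s'2 addn1.
  + by rewrite rs' r5 natr1.
  + by rewrite rs'.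
  + move=> i; rewrite ltnS leq_eqVlt s'2 => /predU1P[ij|ij].
      by exists bk; rewrite ij // eqxx s'6 rs' r5 !r4 // ?addn1 // leqW.
    by rewrite ltn_eqF // rs'; apply: r3.
- by rewrite /= mulnS; lia.
- by [].
Qed.

Lemma copy_loop_runs s : has_input s -> nmem s 2 0 = 0%N -> nmem s 3 0 = 0%N ->
  rmem s 4 0 = level I 0 -> rmem s 2 2 = ymin I ->
  (forall p : 'I_n, rmem s 1 p = py I p) ->
  runs copy_loop s (20 * n.+1) (fun s' =>
    [/\ has_input s', nmem s' 2 0 = 0%N, nmem s' 3 0 = n, rmem s' 2 2 = ymin I
      & forall l, (l <= n)%N -> rmem s' 4 l = level I l]).
Proof.
move=> inp s2 s3 r4 r2 r1; apply: runs_weaken.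
- apply: (runs_while (N := n) (Inv := fun k s' =>
    [/\ has_input s', nmem s' 2 0 = 0%N, nmem s' 3 0 = k,
       rmem s' 2 2 = ymin I /\ (forall p : 'I_n, rmem s' 1 p = py I p)
     & forall l, (l <= k)%N -> rmem s' 4 l = level I l])).
  + by split=> // l; rewrite leqn0 => /eqP->.
  + by move=> k s' [[s'0 _ _] _ s'3 _ _]; rewrite /= s'3 s'0.
  + move=> k s' kn [[s'0 s'1 s'c] s'2 s'3 [r'2 r'1] r'4].
    apply: runs_rset_seq; apply: runs_nset; split=> //=; rewrite /update /=.
      by rewrite s'3 addn1.
    move=> l; rewrite s'3 addn1 leq_eqVlt => /predU1P[->|lk].
      by rewrite eqxx -[k]/(val (Ordinal kn)) level_ord r'1.
    by rewrite ltn_eqF // r'4.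
- by rewrite /=; lia.
- by move=> s' [? ? ? [? _] ?].
Qed.

Lemma backbone_program_runs :
  runs backbone_program (input I) (200 * (n.+1 * m.+1)) (fun s =>
    forall i : 'I_m, exists2 k, leftmost_min n (gap_cost (colorn I) i) k
                              & rmem s 3 i = height I i k).
Proof.
apply: runs_weaken.
- apply: runs_rset_seq; apply: runs_seq.
    apply: copy_loop_runs => //=; first by split=> //= p; rewrite load_ord.
    by move=> p; rewrite /update /= load_ord.
  move=> s [[s0 s1 sc] s2 s3 r2 r4].
  do 2 apply: runs_rset_seq.
  apply: (runs_while (N := m) (Inv := color_inv)).
  + split=> //=; rewrite /update /= => l.
    rewrite s3 addn1 leq_eqVlt => /predU1P[->|ln].
      by rewrite eqxx r2 /level load_out.
    by rewrite ltn_eqF // r4.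
  + by move=> j s' [[_ s'1 _] s'2 _ _ _]; rewrite /= s'1 s'2.
  + by move=> j s'; apply: color_step_runs.
- by rewrite /=; nia.
- by move=> s [_ _ _ _ r3] i; apply: r3.
Qed.

End Program.

(* Without points the heights must still be written, so the bound n * m is
   only meaningful for 0 < n (and then 0 < m); correctness holds for every n. *)
Theorem theorem5 :
  exists (prog : cmd) (K : nat),
    forall (R : realType) (n m : nat) (I : instance R n m),
    exists (s : state R) (t : nat),
      [/\ exec prog (input I) s t,
          crossing_minimal I (@output R m s)
        & (0 < n)%N -> (t <= K * (n * m))%N].
Proof.
(* The factor 4 over 200 comes from [n.+1 * m.+1 <= 4 * (n * m)] for positive [n] and [m]. *)
exists backbone_program, 800%N => R n m I.
have [s [t [exec_s le_t heights]]] := backbone_program_runs I.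
exists s, t; split=> //; first exact: crossing_minimal_heights.
move=> n_gt0; have m_gt0 : (0 < m)%N by case: (color I (Ordinal n_gt0)) => c; lia.
apply: leq_trans le_t _; rewrite -[800%N]/(200 * 4)%N -mulnA leq_mul2l /=; nia.
Qed.
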